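(* Let $(M,g)$ be a Riemannian manifold of dimension at least $3$ with a unit parallel vector field $E$. Let $\gamma$ be a real number such that $\gamma^2\ge\max\{K(\Pi)\mid \Pi \text{ a tangent plane orthogonal to } E\}$, i.e. $\gamma^2\ge K(\Pi)$ for every tangent plane $\Pi$ (at any point of $M$) orthogonal to $E$. Then the Weyl connection defined by $\gamma E$ is non-positive.
   Context: Let $\langle\cdot,\cdot\rangle=g$, let $\nabla$ be the Levi-Civita connection and $K$ the Riemannian sectional curvature. $E$ is parallel if $\nabla_XE=0$ for every vector field $X$. For a vector field $F$ on $M$ let $\varphi=\langle F,\cdot\rangle$. The Weyl connection defined by $F$ is $\widehat\nabla_XY=\nabla_XY+\varphi(Y)X+\varphi(X)Y-\langle X,Y\rangle F$. Let $\widehat R(X,Y)=\widehat\nabla_X\widehat\nabla_Y-\widehat\nabla_Y\widehat\nabla_X-\widehat\nabla_{[X,Y]}$ and $\widehat R_a(X,Y)=\widehat R(X,Y)-d\varphi(X,Y)I$ its anti-symmetric part. For a tangent plane $\Pi$ with orthonormal basis $\{X,Y\}$ put $\widehat K(\Pi)=\langle\widehat R_a(X,Y)Y,X\rangle$; equivalently $\widehat K(\Pi)=K(\Pi)-|F_\perp|^2-\langle\nabla_XF,X\rangle-\langle\nabla_YF,Y\rangle$, where $F_\perp$ is the component of $F$ orthogonal to $\Pi$. The Weyl connection is non-positive if $\widehat K(\Pi)\le 0$ for every tangent plane $\Pi$ at every point. *)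

(* Defs.v *)
From HB Require Import structures.
From mathcomp Require Import all_boot all_order all_algebra.
From mathcomp Require Import all_classical all_reals all_analysis.
From mathcomp Require Import ring.

Set Implicit Arguments.
Unset Strict Implicit.
Unset Printing Implicit Defensive.

Import Order.TTheory GRing.Theory Num.Theory.
Import numFieldNormedType.Exports.

Local Open Scope classical_set_scope.
Local Open Scope ring_scope.

Section SmoothOnOpenSubsets.
Variables (R : realType) (n : nat).
Implicit Types (U : set 'rV[R]_n) (f g : 'rV[R]_n -> R).

Definition partial (i : 'I_n) f : 'rV[R]_n -> R := 'D_(delta_mx 0 i) f.

(* Meant for an open U: the values of f outside U are then irrelevant. *)
Fixpoint Ck_on (k : nat) U f : Prop :=
  (forall x, U x -> {for x, continuous f}) /\
  match k with
  | 0 => True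
  | k'.+1 => forall i : 'I_n,
      (forall x, U x -> derivable f x (delta_mx 0 i)) /\
      Ck_on k' U (partial i f)
  end.

Definition smooth_on U f : Prop := forall k, Ck_on k U f.

Lemma Ck_on_continuous k U f x : Ck_on k U f -> U x -> {for x, continuous f}.
Proof. by case: k => [|k] [fc _]; exact: fc. Qed.

Lemma Ck_onW k U f : Ck_on k.+1 U f -> Ck_on k U f.
Proof.
elim: k f => [|k IH] f; first by case.
by move=> [fc fd]; split=> // i; have [di ci] := fd i; split=> //; exact: IH.
Qed.

Lemma eq_Ck_on k U f g : open U -> (forall x, U x -> f x = g x) ->
  Ck_on k U f -> Ck_on k U g.
Proof.
move=> Uo; have near_eq (h h' : 'rV[R]_n -> R) x : U x ->
    (forall y, U y -> h y = h' y) ->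
    \forall y \near x, h y = h' y.
  by move=> Ux hh'; near=> y; apply: hh'; near: y; exact: open_nbhs_nbhs.
have eqc (h h' : 'rV[R]_n -> R) : (forall y, U y -> h y = h' y) ->
    (forall x, U x -> {for x, continuous h}) ->
    forall x, U x -> {for x, continuous h'}.
  move=> hh' hc x Ux; rewrite /prop_for /continuous_at -(hh' x Ux).
  apply: cvg_trans (hc x Ux); exact: (near_eq_cvg (near_eq _ _ _ Ux hh')).
elim: k f g => [|k IH] f g fg [fc fd]; first by split=> //; exact: eqc fc.
split=> [|i]; first exact: eqc fc.
have [di ci] := fd i; split=> [x Ux|].
  by apply: near_eq_derivable (di x Ux); exact: near_eq.
apply: IH ci => x Ux; rewrite /partial; apply: near_eq_derive.
exact: near_eq.
Unshelve. all: by end_near. Qed.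

Lemma Ck_on_cst k U (a : R) : Ck_on k U (cst a).
Proof.
elim: k a => [|k IH] a; (split=> [x _|]; first exact: cst_continuous) => //.
move=> i; split=> [x _|]; first exact: derivable_cst.
rewrite (_ : partial i (cst a) = cst 0); first exact: IH.
by apply/funext => x; rewrite /partial derive_cst.
Qed.

Lemma Ck_onD k U f g : open U ->
  Ck_on k U f -> Ck_on k U g -> Ck_on k U (f + g).
Proof.
move=> Uo; elim: k f g => [|k IH] f g [fc fd] [gc gd];
  (split=> [x Ux|]; first exact: cvgD (fc x Ux) (gc x Ux)); first by [].
move=> i; have [dfi cfi] := fd i; have [dgi cgi] := gd i.
split=> [x Ux|]; first by apply: derivableD; [exact: dfi|exact: dgi].
apply: eq_Ck_on (IH _ _ cfi cgi) => // x Ux.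
by rewrite /partial deriveD //; [exact: dfi|exact: dgi].
Qed.

Lemma Ck_onM k U f g : open U ->
  Ck_on k U f -> Ck_on k U g -> Ck_on k U (f * g).
Proof.
move=> Uo; elim: k f g => [|k IH] f g cf cg;
  have [fc fd] := cf; have [gc gd] := cg;
  (split=> [x Ux|]; first exact: cvgM (fc x Ux) (gc x Ux)); first by [].
move=> i; have [dfi cfi] := fd i; have [dgi cgi] := gd i.
split=> [x Ux|]; first by apply: derivableM; [exact: dfi|exact: dgi].
apply: eq_Ck_on (Ck_onD Uo (IH _ _ (Ck_onW cf) cgi) (IH _ _ (Ck_onW cg) cfi)).
  by [].
by move=> x Ux; rewrite /partial deriveM //; [exact: dfi|exact: dgi].
Qed.

End SmoothOnOpenSubsets.

Section Manifold.
Variables (R : realType) (n : nat).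

Record chart (M : Type) := Chart {
  chart_dom : set M;
  chart_map :> M -> 'rV[R]_n
}.

(* chart_map c restricts to a homeomorphism from the open set chart_dom c onto
   an open subset of R^n; continuity of the inverse is openness of the map. *)
Definition is_chart (M : topologicalType) (c : chart M) : Prop :=
  [/\ open (chart_dom c),
      {in chart_dom c &, injective c},
      forall p, chart_dom c p -> {for p, continuous c} &
      forall V : set M, V `<=` chart_dom c -> open V -> open (c @` V)].

(* The map tau represents c' \o c^-1 on c (chart_dom c `&` chart_dom c'). *)
Definition smooth_transition (M : Type) (c c' : chart M) : Prop :=
  exists tau : 'rV[R]_n -> 'rV[R]_n,
    (forall i, smooth_on (c @` (chart_dom c `&` chart_dom c'))
                         (fun x => tau x 0 i)) /\
    forall p, chart_dom c p -> chart_dom c' p -> c' p = tau (c p).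

Record smooth_manifold := SmoothManifold {
  point_of :> topologicalType;
  atlas : set (chart point_of);
  manifold_hausdorff : hausdorff_space point_of;
  manifold_second_countable : @second_countable point_of;
  atlas_chart : forall c, atlas c -> is_chart c;
  atlas_cover : forall p, exists2 c, atlas c & chart_dom c p;
  atlas_smooth : forall c c', atlas c -> atlas c' -> smooth_transition c c'
}.

End Manifold.

Section SmoothFunctions.
Variables (R : realType) (n : nat) (M : smooth_manifold R n).

Definition is_smooth (f : M -> R) : Prop :=
  forall c, atlas c -> exists F : 'rV[R]_n -> R,
    smooth_on (c @` chart_dom c) F /\ forall p, chart_dom c p -> f p = F (c p).

Definition smooth_pred : {pred M -> R} := mem [set f | is_smooth f].

Lemma smooth_predP f : reflect (is_smooth f) (f \in smooth_pred).
Proof. by rewrite /smooth_pred; apply: (iffP idP); rewrite inE. Qed.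

Lemma is_smooth_cst (a : R) : is_smooth (cst a).
Proof. by move=> c _; exists (cst a); split=> // k; exact: Ck_on_cst. Qed.

Let image_open (c : chart R n M) : atlas c -> open (c @` chart_dom c).
Proof. by move=> /atlas_chart[+ _ _]; move=> /[swap]; apply. Qed.

Lemma is_smoothD (f g : M -> R) :
  is_smooth f -> is_smooth g -> is_smooth (f + g).
Proof.
move=> fs gs c Ac; have [F [Fs fF]] := fs c Ac; have [G [Gs gG]] := gs c Ac.
exists (F + G); split=> [k|p cp].
  exact: Ck_onD (image_open Ac) (Fs k) (Gs k).
by rewrite !fctE fF // gG.
Qed.

Lemma is_smoothM (f g : M -> R) :
  is_smooth f -> is_smooth g -> is_smooth (f * g).
Proof.
move=> fs gs c Ac; have [F [Fs fF]] := fs c Ac; have [G [Gs gG]] := gs c Ac.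
exists (F * G); split=> [k|p cp].
  exact: Ck_onM (image_open Ac) (Fs k) (Gs k).
by rewrite !fctE fF // gG.
Qed.

Lemma is_smoothN (f : M -> R) : is_smooth f -> is_smooth (- f).
Proof.
move=> fs; rewrite -mulN1r (_ : -1 = cst (-1)) //.
exact: is_smoothM (is_smooth_cst _) fs.
Qed.

Lemma smooth_subring_closed : subring_closed smooth_pred.
Proof.
split=> [|f g|f g]; first by apply/smooth_predP; exact: is_smooth_cst.
- move=> /smooth_predP fs /smooth_predP gs; apply/smooth_predP.
  exact: is_smoothD fs (is_smoothN gs).
- move=> /smooth_predP fs /smooth_predP gs; apply/smooth_predP.
  exact: is_smoothM fs gs.
Qed.

Record smooth_fun := SmoothFun {
  smooth_val :> M -> R;
  _ : smooth_val \in smooth_pred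
}.

HB.instance Definition _ := [isSub for smooth_val].
HB.instance Definition _ := [Choice of smooth_fun by <:].
HB.instance Definition _ :=
  GRing.SubChoice_isSubComPzRing.Build (M -> R) smooth_pred smooth_fun
    smooth_subring_closed.

Definition smooth_cst (a : R) : smooth_fun :=
  SmoothFun (introT (smooth_predP _) (is_smooth_cst a)).

End SmoothFunctions.

Section TangentVectors.
Variables (R : realType) (n : nat) (M : smooth_manifold R n).
Local Notation F := (smooth_fun M).

Lemma smooth_valD (f g : F) (p : M) : (f + g) p = f p + g p. Proof. by []. Qed.
Lemma smooth_valN (f : F) (p : M) : (- f) p = - f p. Proof. by []. Qed.
Lemma smooth_valM (f g : F) (p : M) : (f * g) p = f p * g p. Proof. by []. Qed.

Lemma smooth_fun_ext (f g : F) : (forall p, f p = g p) -> f = g.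
Proof. by move=> fg; apply/val_inj/funext. Qed.

Section At.
Variable p : M.

(* Tangent vectors at p are the derivations at p of the algebra of smooth
   functions. *)
Definition is_tangent (v : F -> R^o) : Prop :=
  (forall a f g, v (smooth_cst M a * f + g) = a * v f + v g) /\
  (forall f g, v (f * g) = v f * g p + f p * v g).

Definition tangent_pred : {pred F -> R^o} := mem [set v | is_tangent v].

Lemma tangent_predP v : reflect (is_tangent v) (v \in tangent_pred).
Proof. by rewrite /tangent_pred; apply: (iffP idP); rewrite inE. Qed.

Lemma tangent_submod_closed : subsemimod_closed tangent_pred.
Proof.
split; [split=> [|u v]|move=> a u].
- apply/tangent_predP; split=> [a f g|f g].
    by change (0 = a * 0 + 0 :> R); ring.
  by change (0 = 0 * g p + f p * 0 :> R); ring.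
- move=> /tangent_predP[ul um] /tangent_predP[vl vm]; apply/tangent_predP.
  split=> [a f g|f g].
    by change (u (smooth_cst M a * f + g) + v (smooth_cst M a * f + g) =
      a * (u f + v f) + (u g + v g)); rewrite ul vl; ring.
  by change (u (f * g) + v (f * g) = (u f + v f) * g p + f p * (u g + v g));
    rewrite um vm; ring.
- move=> /tangent_predP[ul um]; apply/tangent_predP; split=> [b f g|f g].
    by change (a * u (smooth_cst M b * f + g) = b * (a * u f) + a * u g);
      rewrite ul; ring.
  by change (a * u (f * g) = a * u f * g p + f p * (a * u g));
    rewrite um; ring.
Qed.

Record tangent := Tangent {
  tangent_val :> F -> R^o;
  _ : tangent_val \in tangent_pred
}.

HB.instance Definition _ := [isSub for tangent_val].
HB.instance Definition _ := [Choice of tangent by <:].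
HB.instance Definition _ :=
  GRing.SubChoice_isSubLmodule.Build R (F -> R^o) tangent_pred tangent
    tangent_submod_closed.

End At.

(* Vector fields are the derivations of the algebra of smooth functions. *)
Definition is_vfield (X : F -> F^o) : Prop :=
  (forall a f g, X (smooth_cst M a * f + g) = smooth_cst M a * X f + X g) /\
  (forall f g, X (f * g) = X f * g + f * X g).

Definition vfield_pred : {pred F -> F^o} := mem [set X | is_vfield X].

Lemma vfield_predP X : reflect (is_vfield X) (X \in vfield_pred).
Proof. by rewrite /vfield_pred; apply: (iffP idP); rewrite inE. Qed.

Lemma vfield_submod_closed : subsemimod_closed vfield_pred.
Proof.
split; [split=> [|X Y]|move=> h X].
- apply/vfield_predP; split=> [a f g|f g].
    by change (0 = smooth_cst M a * 0 + 0 :> F); ring.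
  by change (0 = 0 * g + f * 0 :> F); ring.
- move=> /vfield_predP[Xl Xm] /vfield_predP[Yl Ym]; apply/vfield_predP.
  split=> [a f g|f g].
    by change (X (smooth_cst M a * f + g) + Y (smooth_cst M a * f + g) =
      smooth_cst M a * (X f + Y f) + (X g + Y g) :> F); rewrite Xl Yl; ring.
  by change (X (f * g) + Y (f * g) = (X f + Y f) * g + f * (X g + Y g) :> F);
    rewrite Xm Ym; ring.
- move=> /vfield_predP[Xl Xm]; apply/vfield_predP; split=> [b f g|f g].
    by change (h * X (smooth_cst M b * f + g) =
      smooth_cst M b * (h * X f) + h * X g :> F); rewrite Xl; ring.
  by change (h * X (f * g) = h * X f * g + f * (h * X g) :> F);
    rewrite Xm; ring.
Qed.

Record vfield := VField {
  vfield_val :> F -> F^o;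
  _ : vfield_val \in vfield_pred
}.

HB.instance Definition _ := [isSub for vfield_val].
HB.instance Definition _ := [Choice of vfield by <:].
HB.instance Definition _ :=
  GRing.SubChoice_isSubLmodule.Build F (F -> F^o) vfield_pred vfield
    vfield_submod_closed.

Lemma vfieldP (X : vfield) : is_vfield X.
Proof. by case: X => X /= /vfield_predP. Qed.

Lemma vfield_ext (X Y : vfield) : (forall f, X f = Y f) -> X = Y.
Proof. by move=> XY; apply/val_inj/funext. Qed.

Lemma value_at_subproof (X : vfield) (p : M) :
  (fun f : F => X f p : R^o) \in tangent_pred p.
Proof.
have [Xl Xm] := vfieldP X.
by apply/tangent_predP; split=> [a f g|f g]; rewrite ?Xl ?Xm.
Qed.

Definition value_at (X : vfield) (p : M) : tangent p :=
  Tangent (value_at_subproof X p).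

Lemma bracket_subproof (X Y : vfield) :
  (fun f : F => X (Y f) - Y (X f) : F^o) \in vfield_pred.
Proof.
have [Xl Xm] := vfieldP X; have [Yl Ym] := vfieldP Y.
have c1 : smooth_cst M 1 = 1 by apply: smooth_fun_ext.
have XD f g : X (f + g) = X f + X g by have := Xl 1 f g; rewrite c1 !mul1r.
have YD f g : Y (f + g) = Y f + Y g by have := Yl 1 f g; rewrite c1 !mul1r.
apply/vfield_predP; split=> [a f g|f g]; first by rewrite !(Xl, Yl); ring.
by rewrite !(Xm, Ym) !(XD, YD) !(Xm, Ym); ring.
Qed.

Definition bracket (X Y : vfield) : vfield := VField (bracket_subproof X Y).

End TangentVectors.

Section RiemannianManifold.
Variables (R : realType) (n : nat) (M : smooth_manifold R n).
Local Notation F := (smooth_fun M).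
Local Notation V := (vfield M).

Record riemannian_metric := RiemannianMetric {
  metric_at :> forall p : M, tangent p -> tangent p -> R;
  metric_sym : forall p (u v : tangent p), metric_at u v = metric_at v u;
  metric_linear : forall p a (u v w : tangent p),
    metric_at (a *: u + v) w = a * metric_at u w + metric_at v w;
  metric_pos : forall p (u : tangent p), u != 0 -> 0 < metric_at u u;
  metric_smooth : forall X Y : V,
    is_smooth (fun p => metric_at (value_at X p) (value_at Y p))
}.

Definition inner (g : riemannian_metric) (X Y : V) : F :=
  SmoothFun (introT (smooth_predP _) (metric_smooth g X Y)).

(* R-linearity in the second argument follows from connDr and connZr. *)
Record affine_connection := AffineConnection {
  conn :> V -> V -> V;
  connDl : forall X Y Z : V, conn (X + Y) Z = conn X Z + conn Y Z;
  connZl : forall (f : F) (X Y : V), conn (f *: X) Y = f *: conn X Y;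
  connDr : forall X Y Z : V, conn X (Y + Z) = conn X Y + conn X Z;
  connZr : forall (f : F) (X Y : V), conn X (f *: Y) = X f *: Y + f *: conn X Y
}.

Definition levi_civita (g : riemannian_metric) (D : affine_connection) : Prop :=
  (forall X Y : V, D X Y - D Y X = bracket X Y) /\
  (forall X Y Z : V, X (inner g Y Z) = inner g (D X Y) Z + inner g Y (D X Z)).

Definition parallel (D : affine_connection) (E : V) : Prop :=
  forall X : V, D X E = 0.

Definition unit_field (g : riemannian_metric) (E : V) : Prop :=
  forall p, g p (value_at E p) (value_at E p) = 1.

Definition curvature (D : affine_connection) (X Y Z : V) : V :=
  D X (D Y Z) - D Y (D X Z) - D (bracket X Y) Z.

Definition ext_deriv (phi : V -> F) (X Y : V) : F :=
  X (phi Y) - Y (phi X) - phi (bracket X Y).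

Lemma vfieldDE (X Y : V) f : (X + Y) f = X f + Y f. Proof. by []. Qed.
Lemma vfieldNE (X : V) f : (- X) f = - X f. Proof. by []. Qed.
Lemma vfieldZE (h : F) (X : V) f : (h *: X) f = h * X f. Proof. by []. Qed.

Lemma value_atD (X Y : V) p : value_at (X + Y) p = value_at X p + value_at Y p.
Proof. by apply/val_inj/funext. Qed.

Lemma value_atZ (h : F) (X : V) p : value_at (h *: X) p = h p *: value_at X p.
Proof. by apply/val_inj/funext. Qed.

Lemma innerC g (X Y : V) : inner g X Y = inner g Y X.
Proof. by apply: smooth_fun_ext => p; exact: metric_sym. Qed.

Lemma innerDl g (X Y Z : V) : inner g (X + Y) Z = inner g X Z + inner g Y Z.
Proof.
apply: smooth_fun_ext => p; rewrite smooth_valD /= value_atD.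
by rewrite -[X in X + _]scale1r metric_linear mul1r.
Qed.

Lemma metric0l (g : riemannian_metric) p (u : tangent p) : g p 0 u = 0.
Proof.
by have := metric_linear g 1 0 0 u; rewrite scaler0 addr0 mul1r => /eqP;
  rewrite eq_sym -subr_eq0 addrK => /eqP.
Qed.

Lemma innerZl g (h : F) (X Y : V) : inner g (h *: X) Y = h * inner g X Y.
Proof.
apply: smooth_fun_ext => p; rewrite smooth_valM /= value_atZ.
by rewrite -[_ *: _]addr0 metric_linear metric0l addr0.
Qed.

Lemma innerDr g (X Y Z : V) : inner g X (Y + Z) = inner g X Y + inner g X Z.
Proof. by rewrite innerC innerDl !(innerC g _ X). Qed.

Lemma innerZr g (h : F) (X Y : V) : inner g X (h *: Y) = h * inner g X Y.
Proof. by rewrite innerC innerZl (innerC g _ X). Qed.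

Section Weyl.
Variables (g : riemannian_metric) (D : affine_connection) (W : V).
Local Notation phi := (inner g W).

Definition weyl_op (X Y : V) : V :=
  D X Y + phi Y *: X + phi X *: Y - inner g X Y *: W.

Let extE := (vfieldDE, vfieldNE, vfieldZE).
Let innE := (innerDl, innerDr, innerZl, innerZr).

Lemma weylDl X Y Z : weyl_op (X + Y) Z = weyl_op X Z + weyl_op Y Z.
Proof.
by apply: vfield_ext => f; rewrite /weyl_op connDl !innE !extE; ring.
Qed.

Lemma weylZl (h : F) X Y : weyl_op (h *: X) Y = h *: weyl_op X Y.
Proof.
by apply: vfield_ext => f; rewrite /weyl_op connZl !innE !extE; ring.
Qed.

Lemma weylDr X Y Z : weyl_op X (Y + Z) = weyl_op X Y + weyl_op X Z.
Proof.
by apply: vfield_ext => f; rewrite /weyl_op connDr !innE !extE; ring.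
Qed.

Lemma weylZr (h : F) X Y : weyl_op X (h *: Y) = X h *: Y + h *: weyl_op X Y.
Proof.
by apply: vfield_ext => f; rewrite /weyl_op connZr !innE !extE; ring.
Qed.

Definition weyl_connection : affine_connection :=
  AffineConnection weylDl weylZl weylDr weylZr.

(* The exterior derivative carries no factor 1/2, so that the endomorphism
   weyl_curvature_anti X Y is skew-adjoint for g. *)
Definition weyl_curvature_anti (X Y Z : V) : V :=
  curvature weyl_connection X Y Z - ext_deriv phi X Y *: Z.

End Weyl.

Definition span2 (p : M) (u v : tangent p) : set (tangent p) :=
  [set w | exists a b : R, w = a *: u + b *: v].

Definition tangent_plane (p : M) (Pi : set (tangent p)) : Prop :=
  exists u v : tangent p,
    (forall a b : R, a *: u + b *: v = 0 -> a = 0 /\ b = 0) /\ Pi = span2 u v.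

Definition orthonormal_basis (g : riemannian_metric) (p : M)
    (Pi : set (tangent p)) (u v : tangent p) : Prop :=
  [/\ Pi = span2 u v, g p u u = 1, g p v v = 1 & g p u v = 0].

(* For a curvature operator Q, plane_curvature g Q Pi k says that
   k = <Q(X,Y)Y,X> at p, for an orthonormal basis of the plane Pi at p extended
   to vector fields X and Y. For the tensorial Q used below such a k exists and
   is unique. *)
Definition plane_curvature (g : riemannian_metric) (Q : V -> V -> V -> V)
    (p : M) (Pi : set (tangent p)) (k : R) : Prop :=
  exists X Y : V, orthonormal_basis g Pi (value_at X p) (value_at Y p) /\
    k = inner g (Q X Y Y) X p.

Definition sectional_curvature g (D : affine_connection) :=
  plane_curvature g (curvature D).

Definition weyl_sectional_curvature g (D : affine_connection) (W : V) :=
  plane_curvature g (weyl_curvature_anti g D W).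

Definition orthogonal_to (g : riemannian_metric) (p : M)
    (Pi : set (tangent p)) (e : tangent p) : Prop :=
  forall w, Pi w -> g p w e = 0.

Definition weyl_nonpositive g (D : affine_connection) (W : V) : Prop :=
  forall (p : M) (Pi : set (tangent p)), tangent_plane Pi ->
  forall k, weyl_sectional_curvature g D W Pi k -> k <= 0.

End RiemannianManifold.

(* Main.v *)
Require Import Defs.
From mathcomp Require Import all_boot all_order all_algebra.
From mathcomp Require Import all_classical all_reals all_analysis.
From mathcomp Require Import ring lra.

Set Implicit Arguments.
Unset Strict Implicit.
Unset Printing Implicit Defensive.

Import Order.TTheory GRing.Theory Num.Theory.
Local Open Scope ring_scope.

(** Let a = <X, E> and b = <Y, E> for an orthonormal basis X, Y of a plane. A
    direct computation of the Weyl curvature (weyl_curvatureE) shows that, for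
    the parallel field gamma E, the Weyl sectional curvature of the plane is
<<
      <R(X, Y)Y, X> - gamma^2 (1 - a^2 - b^2),
>>
    where 1 - a^2 - b^2 is the squared norm of the component of E orthogonal to
    the plane. Because E is parallel, R vanishes as soon as one argument is E,
    so that X and Y may be replaced in the curvature term by their projections
    X' = X - a E and Y' = Y - b E orthogonal to E (curvature_parallel_shift).
    The Gram determinant of X' and Y' is again 1 - a^2 - b^2. If it is nonzero,
    X' and Y' span a plane orthogonal to E and <R(X', Y')Y', X'> is the sectional
    curvature of this plane times the determinant (sectional_curvature_span2),
    hence at most gamma^2 (1 - a^2 - b^2). If it is zero, the plane contains E,
    X' and Y' are dependent and the curvature term vanishes (curvature_gram0).

    Vector fields are global derivations of the algebra of smooth functions, so
    the coefficients of all their linear combinations are taken to be constants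
    or global smooth functions such as <X, E>. *)

(** * Algebra of fields and connections *)

Section WeylCurvature.
Context {R : realType} {n : nat} {M : smooth_manifold R n}.
Local Notation F := (smooth_fun M).
Local Notation V := (vfield M).
Local Notation cst := (smooth_cst M).
Variable g : riemannian_metric M.
Implicit Types (D : affine_connection M) (X Y Z W : V).

Lemma innerNl X Y : inner g (- X) Y = - inner g X Y.
Proof. by rewrite -scaleN1r innerZl mulN1r. Qed.

Lemma innerNr X Y : inner g X (- Y) = - inner g X Y.
Proof. by rewrite innerC innerNl innerC. Qed.

Lemma inner0l X : inner g 0 X = 0.
Proof. by rewrite -(scale0r (0 : V)) innerZl mul0r. Qed.

Definition innerE := (innerDl, innerDr, innerNl, innerNr, innerZl, innerZr).

Lemma connNr D X Y : D X (- Y) = - D X Y.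
Proof.
have D0 : D X 0 = 0 by apply: (addrI (D X 0)); rewrite -connDr !addr0.
by apply/eqP; rewrite -addr_eq0 -connDr addNr D0.
Qed.

Lemma connNl D X Y : D (- X) Y = - D X Y.
Proof. by rewrite -scaleN1r connZl scaleN1r. Qed.

Lemma smooth_fun_eqN0 (f : F) : f = - f -> f = 0.
Proof.
move=> fN; apply: smooth_fun_ext => p.
have : f p = - f p by rewrite [in LHS]fN.
by change (f p = - f p -> f p = 0); lra.
Qed.

Lemma vfieldD X (f h : F) : X (f + h) = X f + X h.
Proof.
have [Xl _] := vfieldP X; have := Xl 1 f h.
by rewrite (_ : cst 1 = 1) ?mul1r //; exact: smooth_fun_ext.
Qed.

Lemma bracketE X Y (f : F) : bracket X Y f = X (Y f) - Y (X f).
Proof. by []. Qed.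

Definition vfieldE := (vfieldDE, vfieldNE, vfieldZE, bracketE).

Lemma vfield0 X : X 0 = 0.
Proof. by apply: (addrI (X 0)); rewrite -vfieldD !addr0. Qed.

Lemma vfieldN X (f : F) : X (- f) = - X f.
Proof. by apply/eqP; rewrite -addr_eq0 -vfieldD addNr vfield0. Qed.

Lemma vfield_cst X a : X (cst a) = 0.
Proof.
have [Xl Xm] := vfieldP X.
have c1 : cst 1 = 1 by exact: smooth_fun_ext.
have X1 : X 1 = 0.
  by apply: (addrI (X 1)); rewrite addr0 -[in RHS](mulr1 1) Xm mulr1 mul1r.
have := Xl a 1 0; rewrite addr0 mulr1 => ->.
by rewrite vfield0 addr0 X1 mulr0.
Qed.

(** * Gram determinants and planes *)

(** The squared area of the parallelogram on X and Y. *)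
Definition gram X Y : F := inner g X X * inner g Y Y - inner g X Y ^+ 2.

Lemma gram_shear (f : F) X Y : gram X (Y + f *: X) = gram X Y.
Proof. by rewrite /gram !innerE (innerC g Y X); ring. Qed.

Lemma inner_ge0 X p : 0 <= inner g X X p.
Proof.
have [X0|X0] := eqVneq (value_at X p) 0; last exact/ltW/metric_pos.
by rewrite /= X0 metric0l.
Qed.

Lemma value_at_eq0 X p : inner g X X p = 0 -> value_at X p = 0.
Proof.
move=> XX; apply/eqP/negPn/negP => /(metric_pos g).
by rewrite -[g p _ _]/(inner g X X p) XX ltxx.
Qed.

Lemma inner_value0 X Y p : value_at Y p = 0 -> inner g X Y p = 0.
Proof. by move=> Y0; rewrite innerC /= Y0 metric0l. Qed.

(** Subtracting from Y its component along X at p leaves the area unchanged.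
    The coefficient is a constant, so that the correction is again a global
    vector field. *)
Lemma gram_schmidt X Y p : inner g X X p != 0 ->
  exists c : R, let Z := Y + cst c *: X in
    inner g X Z p = 0 /\ gram X Y p = inner g X X p * inner g Z Z p.
Proof.
move=> X0; pose c := - inner g X Y p / inner g X X p; exists c => Z.
have XZ : inner g X Z p = 0.
  rewrite /Z innerDr innerZr smooth_valD smooth_valM -[cst c p]/c /c.
  by rewrite divfK // subrr.
split=> //; rewrite -(gram_shear (cst c)) -/Z /gram expr2.
by rewrite smooth_valD smooth_valN !smooth_valM XZ mulr0 subr0.
Qed.

Lemma gram0l X Y p : inner g X X p = 0 -> gram X Y p = 0.
Proof.
move=> X0; rewrite /gram expr2 smooth_valD smooth_valN !smooth_valM X0.
by rewrite (innerC g X Y) (inner_value0 Y (value_at_eq0 X0)) !mul0r subr0.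
Qed.

(** This is the Cauchy-Schwarz inequality. *)
Lemma gram_ge0 X Y p : 0 <= gram X Y p.
Proof.
have [X0|X0] := eqVneq (inner g X X p) 0; first by rewrite gram0l.
by have [c [_ ->]] := gram_schmidt Y X0; rewrite mulr_ge0 ?inner_ge0.
Qed.

Lemma span2_scale_shear (p : M) (u v : tangent p) a b c : a != 0 -> b != 0 ->
  span2 (a *: u) (b *: (v + c *: u)) = span2 u v.
Proof.
move=> a0 b0; apply/seteqP; split=> w [x [y ->]].
  exists (x * a + y * b * c), (y * b).
  by rewrite !scalerDr !scalerDl !scalerA ?mulrA addrA addrAC.
exists ((x - y * c) / a), (y / b).
rewrite !scalerA !divfK // scalerDr scalerA scalerBl.
by rewrite addrCA addrC subrK addrC.
Qed.

Lemma tangent_plane_span2 X Y p : gram X Y p != 0 ->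
  tangent_plane (span2 (value_at X p) (value_at Y p)).
Proof.
move=> G0; exists (value_at X p), (value_at Y p); split=> // a b ab0.
have Z0 : value_at (cst a *: X + cst b *: Y) p = 0.
  by rewrite value_atD !value_atZ.
have := inner_value0 X Z0; have := inner_value0 Y Z0.
move: G0; rewrite /gram !innerE expr2 !(smooth_valD, smooth_valN, smooth_valM).
rewrite (innerC g Y X) -[cst a p]/a -[cst b p]/b => G0 eY eX.
(* Cramer's rule for the pairing of a X + b Y = 0 with X and Y *)
split; apply/eqP; rewrite -(mulIr_eq0 _ (mulIf G0)); apply/eqP.
  transitivity ((a * inner g X X p + b * inner g X Y p) * inner g Y Y p -
    (a * inner g X Y p + b * inner g Y Y p) * inner g X Y p); first by ring.
  by rewrite eX eY !mul0r subrr.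
transitivity ((a * inner g X Y p + b * inner g Y Y p) * inner g X X p -
    (a * inner g X X p + b * inner g X Y p) * inner g X Y p); first by ring.
by rewrite eX eY !mul0r subrr.
Qed.

(** * Curvature of the Levi-Civita connection *)

Section LeviCivita.
Context {D : affine_connection M} (lc : levi_civita g D).

Lemma curvatureC X Y Z : curvature D Y X Z = - curvature D X Y Z.
Proof.
rewrite /curvature (_ : bracket Y X = - bracket X Y) ?connNl.
  by rewrite opprK !opprD !opprK [in RHS]addrC addrCA addrA addrC addrA.
by apply: vfield_ext => f; rewrite vfieldNE /= opprB.
Qed.

Lemma curvatureDl X Y Z W :
  curvature D (X + Y) Z W = curvature D X Z W + curvature D Y Z W.
Proof.
rewrite /curvature (_ : bracket (X + Y) Z = bracket X Z + bracket Y Z).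
  by rewrite !(connDl, connDr); apply: vfield_ext => f;
    rewrite !vfieldE; ring.
by apply: vfield_ext => f; rewrite !(vfieldE, vfieldD); ring.
Qed.

Lemma curvatureZl (f : F) X Y Z :
  curvature D (f *: X) Y Z = f *: curvature D X Y Z.
Proof.
have fX : bracket (f *: X) Y = f *: bracket X Y - Y f *: X.
  apply: vfield_ext => h; have [_ Ym] := vfieldP Y.
  by rewrite !(vfieldE, Ym); ring.
rewrite /curvature fX !(connDl, connNl, connZl, connZr).
by apply: vfield_ext => h; rewrite !vfieldE; ring.
Qed.

Lemma curvatureDr X Y Z W :
  curvature D X Y (Z + W) = curvature D X Y Z + curvature D X Y W.
Proof.
rewrite /curvature !connDr.
by apply: vfield_ext => f; rewrite !vfieldE; ring.
Qed.

Lemma curvatureZr (f : F) X Y Z :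
  curvature D X Y (f *: Z) = f *: curvature D X Y Z.
Proof.
rewrite /curvature !(connZr, connDr).
by apply: vfield_ext => h; rewrite !vfieldE; ring.
Qed.

Lemma curvatureDm X Y Z W :
  curvature D X (Y + Z) W = curvature D X Y W + curvature D X Z W.
Proof. by rewrite curvatureC curvatureDl opprD -!curvatureC. Qed.

Lemma curvatureZm (f : F) X Y Z :
  curvature D X (f *: Y) Z = f *: curvature D X Y Z.
Proof. by rewrite curvatureC curvatureZl -scalerN -curvatureC. Qed.

Lemma curvatureXX X Z : curvature D X X Z = 0.
Proof.
by apply: vfield_ext => f; apply: smooth_fun_eqN0; rewrite {1}curvatureC.
Qed.

(** The operator [X, Y] - (XY - YX) kills the function <Z, W>; metric
    compatibility turns this into skew-adjointness of the curvature. *)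
Lemma curvature_skew X Y Z W :
  inner g (curvature D X Y Z) W = - inner g (curvature D X Y W) Z.
Proof.
have [_ mc] := lc.
have /eqP := mc (bracket X Y) Z W.
rewrite bracketE !(mc, vfieldD) -subr_eq0 => /eqP H.
apply/eqP; rewrite -addr_eq0 -[X in _ == X]H /curvature !innerE; apply/eqP.
rewrite !(innerC g Z) (innerC g (D Y Z) (D X W)) (innerC g (D X Z) (D Y W)).
by ring.
Qed.

(** Vanishing torsion reduces this cyclic sum to the Jacobi identity. *)
Lemma bianchi X Y Z :
  curvature D X Y Z + curvature D Y Z X + curvature D Z X Y = 0.
Proof.
have [tf _] := lc.
have H A B C :
    D (bracket A B) C = D C (D A B) - D C (D B A) + bracket (bracket A B) C.
  have -> : D C (D A B) - D C (D B A) = D C (bracket A B).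
    by rewrite -tf connDr connNr.
  by rewrite -[bracket (bracket A B) C]tf addrC subrK.
rewrite /curvature !H; apply: vfield_ext => f.
rewrite !(vfieldE, vfieldD, vfieldN); change ((0 : V) f) with (0 : F).
by ring.
Qed.

Section Parallel.
Context {E : V} (Ep : parallel D E).

Lemma curvature_parallel_arg X Y : curvature D X Y E = 0.
Proof.
have D0 Z : D Z 0 = 0 by apply: (addrI (D Z 0)); rewrite -connDr !addr0.
by rewrite /curvature !Ep !D0 !subrr.
Qed.

(** By the Bianchi identity, T(Y, Z, W) = <R(E, Y)Z, W> is symmetric in Y and
    Z, because R(Y, Z)E = 0; it is skew in Z and W. Such a trilinear map is
    zero: alternating the two exchanges three times gives T = - T. *)
Lemma curvature_parallel_dir Y Z W : inner g (curvature D E Y Z) W = 0.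
Proof.
have sym A B : curvature D E A B = curvature D E B A.
  have := bianchi A B E; rewrite curvature_parallel_arg add0r curvatureC.
  by rewrite addrC => /eqP; rewrite subr_eq0 => /eqP.
apply: smooth_fun_eqN0.
rewrite [LHS]curvature_skew (sym Y W) [in LHS]curvature_skew opprK (sym W Z).
by rewrite [LHS]curvature_skew (sym Z Y).
Qed.

(** This is what allows the plane to be projected onto the orthogonal
    complement of E. *)
Lemma curvature_parallel_shift (f h : F) X Y :
  let X' := X + f *: E in let Y' := Y + h *: E in
  inner g (curvature D X' Y' Y') X' = inner g (curvature D X Y Y) X.
Proof.
rewrite /= curvatureDr curvatureZr curvature_parallel_arg scaler0 addr0.
rewrite innerDr innerZr [X in _ + _ * X]curvature_skew curvature_parallel_arg.
rewrite !(curvatureDl, curvatureZl, curvatureDm, curvatureZm).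
rewrite (curvatureC E X) inner0l.
have := curvature_parallel_dir X Y X.
have := curvature_parallel_dir Y Y X; have := curvature_parallel_dir E Y X.
(* The curvature fields are generalized because innerE would otherwise split
   the differences that define them. *)
move: (curvature D X Y Y) (curvature D E X Y) (curvature D E Y Y).
move: (curvature D E E Y) => A B C C' A0 C0 B0.
by rewrite !innerE A0 C0 B0; ring.
Qed.

End Parallel.

Lemma curvature_shear (f : F) X Y :
  let Y' := Y + f *: X in
  inner g (curvature D X Y' Y') X = inner g (curvature D X Y Y) X.
Proof.
rewrite /= curvatureDm curvatureZm curvatureXX scaler0 addr0.
rewrite curvatureDr curvatureZr innerDl innerZl.
suff -> : inner g (curvature D X Y X) X = 0 by rewrite mulr0 addr0.
by apply: smooth_fun_eqN0; rewrite [LHS]curvature_skew.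
Qed.

(** The values of X and Y at p are dependent. If X does not vanish at p, then a
    shear replaces Y by a field that vanishes there, and skew-adjointness moves
    this field to the last slot, where only its value at p matters. *)
Lemma curvature_gram0 X Y p :
  gram X Y p = 0 -> inner g (curvature D X Y Y) X p = 0.
Proof.
have [X0 _|X0] := eqVneq (inner g X X p) 0.
  exact/inner_value0/value_at_eq0.
have [c] := gram_schmidt Y X0; set Z := Y + _ => -[XZ ->].
move=> /eqP; rewrite mulf_eq0 (negPf X0) orFb => /eqP /value_at_eq0 Z0.
rewrite -(curvature_shear (cst c)) -/Z curvature_skew.
by rewrite smooth_valN inner_value0 ?oppr0.
Qed.

(** After a shear that makes Y orthogonal to X at p, constant factors a and b
    normalize the two fields at p; the curvature form is then scaled by
    (a b)^2, which is the inverse of the Gram determinant at p. *)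
Lemma sectional_curvature_span2 X Y p : gram X Y p != 0 ->
  sectional_curvature g D (span2 (value_at X p) (value_at Y p))
    (inner g (curvature D X Y Y) X p / gram X Y p).
Proof.
move=> G0; have X0 : inner g X X p != 0.
  by apply: contra G0 => /eqP X0; rewrite gram0l.
have [c] := gram_schmidt Y X0.
set Z := Y + _ => -[XZ GE]; rewrite -(curvature_shear (cst c)) -/Z.
have Z0 : inner g Z Z p != 0.
  by move: G0; rewrite GE mulf_eq0 negb_or => /andP[].
have normE W : inner g W W p != 0 ->
    exists2 a : R, a != 0 & a * a * inner g W W p = 1.
  move=> W0; exists (Num.sqrt (inner g W W p))^-1.
    by rewrite invr_eq0 sqrtr_eq0 -ltNge lt_def W0 inner_ge0.
  by rewrite -invfM -expr2 sqr_sqrtr ?inner_ge0 // mulVf.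
have [a a0 aX] := normE X X0; have [b b0 bZ] := normE Z Z0.
exists (cst a *: X), (cst b *: Z); split.
  split; first by rewrite !value_atZ value_atD value_atZ span2_scale_shear.
  - change (inner g (cst a *: X) (cst a *: X) p = 1).
    by rewrite !(innerZl, innerZr) !smooth_valM -aX mulrA.
  - change (inner g (cst b *: Z) (cst b *: Z) p = 1).
    by rewrite !(innerZl, innerZr) !smooth_valM -bZ mulrA.
  - change (inner g (cst a *: X) (cst b *: Z) p = 0).
    by rewrite !(innerZl, innerZr) !smooth_valM XZ !mulr0.
rewrite !(curvatureZl, curvatureZm, curvatureZr) !(innerZl, innerZr).
rewrite !smooth_valM -[cst a p]/a -[cst b p]/b GE.
move: (inner g _ X p) => k; apply: (mulIf (mulf_neq0 X0 Z0)).
rewrite divfK ?mulf_neq0 // -[LHS]mulr1 -[in LHS](mulr1 k) -{1}aX -{1}bZ.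
by ring.
Qed.

(** * The Weyl curvature *)

(** For orthonormal X and Y this is the classical formula
    K - |W_perp|^2 - <D_X W, X> - <D_Y W, Y>, since then
    |W_perp|^2 = |W|^2 - <W, X>^2 - <W, Y>^2. *)
Lemma weyl_curvatureE W X Y :
  inner g (weyl_curvature_anti g D W X Y Y) X =
  inner g (curvature D X Y Y) X
  - inner g W W * gram X Y
  + (inner g W X ^+ 2 * inner g Y Y + inner g W Y ^+ 2 * inner g X X
     - inner g X Y * (inner g W X * inner g W Y) *+ 2)
  - inner g (D X W) X * inner g Y Y - inner g (D Y W) Y * inner g X X
  + inner g X Y * (inner g (D X W) Y + inner g (D Y W) X).
Proof.
have [tf mc] := lc.
rewrite /weyl_curvature_anti /curvature /= /weyl_op /ext_deriv /gram.
rewrite !(connDr, connNr, connZr) !mc !innerE.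
(* Both sides keep the one derivative along a bracket as an atom, with the
   bracket written as the difference of covariant derivatives. *)
rewrite -!tf !innerE (innerC g Y X) (innerC g X W) (innerC g Y W).
by ring.
Qed.

End LeviCivita.
End WeylCurvature.

(** * Non-positivity *)

Theorem proposition2p4 (R : realType) (n : nat) (n_ge3 : (3 <= n)%N)
  (M : smooth_manifold R n) (g : riemannian_metric M)
  (D : affine_connection M) (D_levi_civita : levi_civita g D)
  (E : vfield M) (E_unit : unit_field g E) (E_parallel : parallel D E)
  (gamma : R)
  (gamma_bound : forall (p : M) (Pi : set (tangent p)),
     tangent_plane Pi -> orthogonal_to g Pi (value_at E p) ->
     forall k : R, sectional_curvature g D Pi k -> k <= gamma ^+ 2) :
  weyl_nonpositive g D (smooth_cst M gamma *: E).
Proof.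
have EE : inner g E E = 1 by apply: smooth_fun_ext => p; exact: E_unit.
have bound p X Y : inner g X E p = 0 -> inner g Y E p = 0 ->
    inner g (curvature D X Y Y) X p <= gamma ^+ 2 * gram g X Y p.
  move=> XE YE; have [G0|G0] := eqVneq (gram g X Y p) 0.
    by rewrite (curvature_gram0 D_levi_civita G0) G0 mulr0.
  rewrite -ler_pdivrMr; last by rewrite lt_def G0 gram_ge0.
  apply: gamma_bound (sectional_curvature_span2 D_levi_civita G0).
    exact: (tangent_plane_span2 G0).
  move=> w [a [b ->]]; rewrite metric_linear -[b *: _]addr0 metric_linear.
  rewrite metric0l -[g p (value_at X p) _]/(inner g X E p) XE.
  by rewrite -[g p (value_at Y p) _]/(inner g Y E p) YE !mulr0 !addr0.
move=> p Pi _ k [X [Y [[_ XX YY XY] ->]]].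
have parW Z : D Z (smooth_cst M gamma *: E) = 0.
  by rewrite connZr E_parallel vfield_cst scale0r scaler0 addr0.
rewrite (weyl_curvatureE D_levi_civita) !parW !inner0l.
pose X' := X + (- inner g X E) *: E; pose Y' := Y + (- inner g Y E) *: E.
have {}bound :
    inner g (curvature D X' Y' Y') X' p <= gamma ^+ 2 * gram g X' Y' p.
  by apply: bound; rewrite innerDl innerZl EE mulr1 subrr.
move: bound; rewrite (curvature_parallel_shift D_levi_civita E_parallel).
rewrite !(smooth_valD, smooth_valN, smooth_valM) mul0r.
move: (inner g (curvature D X Y Y) X p) => r.
rewrite /gram !innerE EE (innerC g E X) (innerC g E Y) !expr2.
rewrite !(smooth_valD, smooth_valN, smooth_valM).
change (inner g X X p = 1) in XX; change (inner g Y Y p = 1) in YY.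
change (inner g X Y p = 0) in XY.
rewrite XX YY XY -[smooth_cst M gamma p]/gamma.
rewrite -[(1 : smooth_fun M) p]/(1 : R) -[(0 : smooth_fun M) p]/(0 : R).
(* With a = <X, E> and b = <Y, E>, the Gram determinant of X' and Y' and the
   squared norm of the component of E orthogonal to the plane are both
   1 - a^2 - b^2. *)
move: (inner g X E p) (inner g Y E p) => a b.
nra.
Qed.
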